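(* Let $\mathcal O_{c,\epsilon,\beta,\gamma}:\Delta(\mathcal Y)\to\mathcal P_{\mathcal O}$ be a $(c,\epsilon,\beta,\gamma)$-optimal stable policy oracle. For $\pi\in\Delta(\mathcal Y)$ let $p^{\mathrm{opt}}(\pi)\in\arg\max_{p_0\in\mathcal P_0}V(a^*(p_0,\pi,\epsilon),p_0,\pi)$ and $a^{\mathrm{opt}}(\pi)=a^*(p^{\mathrm{opt}}(\pi),\pi,\epsilon)$. Define the collections of events (functions of the forecast $\pi$) $$\mathcal E_1=\{\mathbf 1[(\mathcal O_{c,\epsilon,\beta,\gamma}(\pi),a^*(\mathcal O_{c,\epsilon,\beta,\gamma}(\pi),\pi))=(p,r)]\}_{p\in\mathcal P_{\mathcal O},r\in\mathcal A},$$ $$\mathcal E_2=\{\mathbf 1[(p^{\mathrm{opt}}(\pi),a^{\mathrm{opt}}(\pi))=(p,a)]\}_{p\in\mathcal P_0,a\in\mathcal A},\qquad \mathcal E_3=\{\mathbf 1[a^*(p_0,\pi)=a]\}_{p_0\in\mathcal P_0,a\in\mathcal A},$$ and $\mathcal E=\mathcal E_1\cup\mathcal E_2\cup\mathcal E_3$. Assume that the Agent's learning algorithm $\mathcal L$ satisfies the No Contextual Swap Regret assumption (with parameter $\epsilon_{\mathrm{swap}}$) and the No Secret Information assumption. Let $\sigma^\dagger$ be the mechanism that runs the forecasting algorithm of Noarov et al. for the events $\mathcal E$ and uses the choice rule $p_t=\mathcal O_{c,\epsilon,\beta,\gamma}(\pi_t)$. Then $$\mathrm{PR}(\sigma^\dagger,\mathcal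 L,y_{1:T})\le\tilde{O}\left(c+\gamma+\sqrt{\frac{|\mathcal P_0||\mathcal A|}{T}}+\frac{\epsilon_{\mathrm{swap}}+|\mathcal Y|\sqrt{|\mathcal P_{\mathcal O}||\mathcal A|/T}}{\beta}+\frac{\epsilon_{\mathrm{swap}}+|\mathcal Y|\sqrt{|\mathcal A|/T}}{\epsilon}\right),$$ where $\tilde O$ ignores logarithmic factors in $T,|\mathcal Y|,|\mathcal P_{\mathcal O}|,|\mathcal P_0|,|\mathcal A|$.
   Context: Model. $\mathcal P$ is a policy space, $\mathcal A$ a finite action space, $\mathcal Y$ a finite state space (states and actions are identified with one-hot vectors), $\mathcal P_0\subseteq\mathcal P$ a finite set of benchmark policies. The Agent's utility is $U(a,p,y)\in[-1,1]$ and the Principal's is $V(a,p,y)\in[-1,1]$. For $\pi\in\Delta(\mathcal Y)$ write $U(a,p,\pi)=\mathbb E_{y\sim\pi}U(a,p,y)$, $V(a,p,\pi)=\mathbb E_{y\sim\pi}V(a,p,y)$; for $\mu\in\Delta(\mathcal A)$ write $U(\mu,p,y)=\mathbb E_{a\sim\mu}U(a,p,y)$ and similarly $V(\mu,p,y)$. $a^*(p,\pi)$ is a fixed choice of element maximizing $V(\cdot,p,\pi)$ over $\arg\max_{a}U(a,p,\pi)$. $\mathcal B(p,\pi,\epsilon)=\{a: U(a,p,\pi)\ge U(a^*(p,\pi),p,\pi)-\epsilon\}$ and $a^*(p,\pi,\epsilon)\in\arg\max_{a\in\mathcal B(p,\pi,\epsilon)}V(a,p,\pi)$. Argmax ties are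 broken by arbitrary fixed rules. Interaction. A mechanism is a pair (forecasting algorithm $\mathcal F$, deterministic choice rule $\psi:\Delta(\mathcal Y)\to\mathcal P$). The state sequence $y_{1:T}$ is arbitrary. In round $t$: $\mathcal F$ (possibly randomized, based on the past but not on the Agent's actions) produces $\pi_t\in\Delta(\mathcal Y)$; the Principal announces policy $p_t=\psi(\pi_t)$ and recommendation $r_t=a^*(p_t,\pi_t)$; the Agent draws $a_t\sim\mathcal L_t(y_{1:t-1},a_{1:t-1},r_{1:t},p_{1:t})\in\Delta(\mathcal A)$, where $\mathcal L$ is his learning algorithm; then $y_t$ is revealed. For $p_0\in\mathcal P_0$, the constant mechanism $\sigma^{p_0}$ plays $p_0$ every round with recommendation $r_t^{p_0}=a^*(p_0,\pi_t)$ (same forecasts); $a^{p_0}_{1:T}$ denotes the actions $\mathcal L$ generates against it. The Principal's policy regret is $$\mathrm{PR}(\psi,\pi_{1:T},\mathcal L,y_{1:T})=\max_{p_0\in\mathcal P_0}\mathbb E_{a_{1:T},a^{p_0}_{1:T}}\Big[\tfrac1T\sum_{t=1}^T\big(V(a_t^{p_0},p_0,y_t)-V(a_t,p_t,y_t)\big)\Big],$$ and for $\sigma^\dagger=(\mathcal F,\psi)$, $\mathrm{PR}(\sigma^\dagger,\mathcal L,y_{1:T})=\mathbb E_{\pi_{1:T}}[\mathrm{PR}(\psi,\pi_{1:T},\mathcal L,y_{1:T})]$. No Contextual Swap Regret (parameter $\epsilon_{\mathrm{swap}}$): given the states and the realized policies/recommendations, $\mathbb E_{a_{1:T}}\big[\max_{h:\mathcal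 P\times\mathcal A\times\mathcal A\to\mathcal A}\frac1T\sum_t(U(h(p_t,r_t,a_t),p_t,y_t)-U(a_t,p_t,y_t))\big]\le\epsilon_{\mathrm{swap}}$, and for all $p_0\in\mathcal P_0$ the same holds with $(p_t,r_t,a_t)$ replaced by $(p_0,r_t^{p_0},a_t^{p_0})$. No Secret Information: for every fixed forecast sequence and every $(p,r)\in\mathcal P\times\mathcal A$, with $n_{p,r}=|\{t:(p_t,r_t)=(p,r)\}|$ and $\hat\mu_{p,r}=\frac1{n_{p,r}}\sum_{t:(p_t,r_t)=(p,r)}a_t$ (empirical action distribution), $\frac1{n_{p,r}}\mathbb E_{a_{1:T}}\big|\sum_{t:(p_t,r_t)=(p,r)}(U(a_t,p,y_t)-U(\hat\mu_{p,r},p,y_t))\big|\le O(1/\sqrt{n_{p,r}})$, and the same with $V$ in place of $U$; and for all $p_0\in\mathcal P_0$, $r\in\mathcal A$, with $n_r^{p_0}=|\{t:r_t^{p_0}=r\}|$ and $\hat\mu_r^{p_0}=\frac1{n_r^{p_0}}\sum_{t:r_t^{p_0}=r}a_t^{p_0}$, $\frac1{n_r^{p_0}}\mathbb E_{a^{p_0}_{1:T}}\big|\sum_{t:r_t^{p_0}=r}(U(a_t^{p_0},p_0,y_t)-U(\hat\mu_r^{p_0},p_0,y_t))\big|\le O(1/\sqrt{n_r^{p_0}})$, and the same with $V$ in place of $U$. Stability. For $\beta,\gamma$, a policy $p$ is $(\beta,\gamma)$-stable under $\pi$ if for every $a\ne a^*(p,\pi)$ either $U(a,p,\pi)\le U(a^*(p,\pi),p,\pi)-\beta$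 or $V(a,p,\pi)\ge V(a^*(p,\pi),p,\pi)-\gamma$. $p$ is a $(c,\epsilon,\beta,\gamma)$-optimal stable policy under $\pi$ if it is $(\beta,\gamma)$-stable under $\pi$ and $V(a^*(p,\pi),p,\pi)\ge V(a^*(p_0,\pi,\epsilon),p_0,\pi)-c$ for all $p_0\in\mathcal P_0$. A $(c,\epsilon,\beta,\gamma)$-optimal stable policy oracle maps each $\pi\in\Delta(\mathcal Y)$ to a $(c,\epsilon,\beta,\gamma)$-optimal stable policy under $\pi$; $\mathcal P_{\mathcal O}\subseteq\mathcal P$ is its set of possible outputs. Forecasting algorithm (known result of Noarov, Ramalingam, Roth, Xie 2023, which may be used). An event is a function $E:\Delta(\mathcal Y)\to\{0,1\}$; $\pi_{1:T}$ has bias $\alpha$ conditional on $\mathcal E$ if $\frac1T\|\sum_tE(\pi_t)(\pi_t-y_t)\|_1\le\alpha(E)$ for all $E\in\mathcal E$. For any collection $\mathcal E$ of (polynomial-time evaluable) events there is a forecasting algorithm, running in time polynomial in $|\mathcal Y|$ and $|\mathcal E|$ per round, such that for every (adversarial) $y_{1:T}$ its expected conditional bias satisfies $\mathbb E_{\pi_{1:T}}[\alpha(E)]\le O\Big(\frac{|\mathcal Y|\ln(|\mathcal Y||\mathcal E|T)}{T}+\frac{|\mathcal Y|\sqrt{\ln(|\mathcal Y||\mathcal E|T)\,|\{t:E(\pi_t)=1\}|}}{T}\Big)\le O\Big(\frac{|\mathcal Y|\sqrt{\ln(|\mathcal Y||\mathcal E|T)}}{\sqrt T}\Big)$.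
   Formalization: The forecasting guarantee is assumed simultaneously over events (the expected maximum over events of bias minus a constant times its rate is at most 0), not event by event, and the constant in the bound may depend on an upper bound for β; without these the claim fails. *)

(* Defs.v *)
From HB Require Import structures.
From mathcomp Require Import all_boot all_order all_algebra.
From mathcomp Require Import finmap.
From mathcomp Require Import all_classical all_reals all_analysis.

Set Implicit Arguments.
Unset Strict Implicit.
Unset Printing Implicit Defensive.

Import Order.TTheory GRing.Theory Num.Theory.

Local Open Scope classical_set_scope.
Local Open Scope ring_scope.

Definition is_dist (R : realType) (T : finType) (f : {ffun T -> R}) : bool :=
  [forall x, 0 <= f x] && (\sum_x f x == 1).

Record dist (R : realType) (T : finType) : Type := Dist {
  mass :> {ffun T -> R};
  massP : is_dist mass }.
HB.instance Definition _ (R : realType) (T : finType) :=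
  [isSub for @mass R T].

Section Game.
Context (R : realType) (Y A : finType) (P : choiceType).
Implicit Types (u U V : A -> P -> Y -> R) (p : P) (a r : A).
Implicit Types (pi : dist R Y) (astar : P -> dist R Y -> A).

Definition util_state u a p pi : R := \sum_y pi y * u a p y.

Definition util_mix u (mu : A -> R) p (y : Y) : R := \sum_a mu a * u a p y.

(* The choices a*, a*(.,.,eps) and p^opt are arbitrary selections, constrained
   only by the argmax they have to lie in: this is how ties are left open. *)

Definition agent_optimal U p pi a : Prop :=
  forall b, util_state U b p pi <= util_state U a p pi.

Definition is_astar U V astar : Prop :=
  forall p pi, agent_optimal U p pi (astar p pi) /\
    forall a, agent_optimal U p pi a ->
      util_state V a p pi <= util_state V (astar p pi) p pi.

Definition near_optimal U astar (eps : R) p pi a : Prop :=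
  util_state U a p pi >= util_state U (astar p pi) p pi - eps.

Definition is_astar_eps U V astar (eps : R) (aeps : P -> dist R Y -> A) : Prop :=
  forall p pi, near_optimal U astar eps p pi (aeps p pi) /\
    forall a, near_optimal U astar eps p pi a ->
      util_state V a p pi <= util_state V (aeps p pi) p pi.

Definition is_popt V (P0 : {fset P}) (aeps : P -> dist R Y -> A)
    (popt : dist R Y -> P) : Prop :=
  forall pi, popt pi \in P0 /\
    forall p0, p0 \in P0 ->
      util_state V (aeps p0 pi) p0 pi <=
      util_state V (aeps (popt pi) pi) (popt pi) pi.

Definition stable U V astar (beta gamma : R) p pi : Prop :=
  forall a, a != astar p pi ->
    util_state U a p pi <= util_state U (astar p pi) p pi - beta \/
    util_state V a p pi >= util_state V (astar p pi) p pi - gamma.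

Definition optimal_stable U V (P0 : {fset P}) astar (aeps : P -> dist R Y -> A)
    (c beta gamma : R) p pi : Prop :=
  stable U V astar beta gamma p pi /\
  forall p0, p0 \in P0 ->
    util_state V (astar p pi) p pi >= util_state V (aeps p0 pi) p0 pi - c.

Definition optimal_stable_oracle U V (P0 : {fset P}) astar
    (aeps : P -> dist R Y -> A) (c beta gamma : R) (O : dist R Y -> P) : Prop :=
  forall pi, optimal_stable U V P0 astar aeps c beta gamma (O pi) pi.

Definition event : Type := dist R Y -> bool.

Definition events1 astar (O : dist R Y -> P) : set event :=
  [set E | exists p r, range O p /\
     E = (fun pi => (O pi, astar (O pi) pi) == (p, r))].

Definition events2 (P0 : {fset P}) (aeps : P -> dist R Y -> A)
    (popt : dist R Y -> P) : set event :=
  [set E | exists p a, p \in P0 /\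
     E = (fun pi => (popt pi, aeps (popt pi) pi) == (p, a))].

Definition events3 (P0 : {fset P}) astar : set event :=
  [set E | exists p0 a, p0 \in P0 /\ E = (fun pi => astar p0 pi == a)].

Definition all_events (P0 : {fset P}) astar (aeps : P -> dist R Y -> A)
    (popt O : dist R Y -> P) : set event :=
  events1 astar O `|` events2 P0 aeps popt `|` events3 P0 astar.

(* The number of elements of a finite set (0 for an infinite one). *)
Definition cardinal (T : choiceType) (S : set T) : nat := #|` fset_set S|.

Section Interaction.
Context (T : nat).
Implicit Types (y : T.-tuple Y) (pis : T.-tuple (dist R Y)).
Implicit Types (ps : T.-tuple P) (rs acts : T.-tuple A).

(* A learning algorithm receives y_{1:t-1}, a_{1:t-1}, r_{1:t}, p_{1:t}. *)
Definition learner : Type := seq Y -> seq A -> seq A -> seq P -> dist R A.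

Definition recommendations astar ps pis : T.-tuple A :=
  [tuple astar (tnth ps t) (tnth pis t) | t < T].

Definition constant_policies p : T.-tuple P := [tuple p | _ < T].

Definition action_law (L : learner) y ps rs acts : R :=
  \prod_(t < T) L (take t y) (take t acts) (take t.+1 rs) (take t.+1 ps)
                  (tnth acts t).

Definition expect_actions (L : learner) y ps rs (f : T.-tuple A -> R) : R :=
  \sum_(acts : T.-tuple A) action_law L y ps rs acts * f acts.

(* The two action sequences are drawn independently; by linearity of the
   expectation their coupling is immaterial. *)
Definition policy_regret V (P0 : {fset P}) astar (psi : dist R Y -> P)
    pis (L : learner) y : R :=
  let ps := map_tuple psi pis in
  let rs := recommendations astar ps pis in
  sup [set expect_actions L y ps rs (fun acts =>
             let ps0 := constant_policies p0 in
             let rs0 := recommendations astar ps0 pis in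
             expect_actions L y ps0 rs0 (fun acts0 =>
               T%:R^-1 * \sum_(t < T)
                 (V (tnth acts0 t) p0 (tnth y t) -
                  V (tnth acts t) (tnth ps t) (tnth y t))))
      | p0 in [set` P0]].

Definition swap_regret U y ps rs acts : R :=
  sup (range (fun h : P * A * A -> A =>
    T%:R^-1 * \sum_(t < T)
      (U (h (tnth ps t, tnth rs t, tnth acts t)) (tnth ps t) (tnth y t) -
       U (tnth acts t) (tnth ps t) (tnth y t)))).

Definition no_contextual_swap_regret U (P0 : {fset P}) astar
    (psi : dist R Y -> P) (eps_swap : R) (L : learner) y pis : Prop :=
  let bounded ps :=
    let rs := recommendations astar ps pis in
    expect_actions L y ps rs (swap_regret U y ps rs) <= eps_swap in
  bounded (map_tuple psi pis) /\
  forall p0, p0 \in P0 -> bounded (constant_policies p0).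

Definition in_context ps rs p r (t : 'I_T) : bool :=
  (tnth ps t, tnth rs t) == (p, r).

Definition context_count ps rs p r : nat := \sum_(t < T) in_context ps rs p r t.

Definition empirical_actions ps rs acts p r (a : A) : R :=
  (context_count ps rs p r)%:R^-1 *
  \sum_(t < T | in_context ps rs p r t) (tnth acts t == a)%:R.

Definition secret_information u (L : learner) y ps rs p r : R :=
  (context_count ps rs p r)%:R^-1 *
  expect_actions L y ps rs (fun acts =>
    `| \sum_(t < T | in_context ps rs p r t)
         (u (tnth acts t) p (tnth y t) -
          util_mix u (empirical_actions ps rs acts p r) p (tnth y t)) |).

(* K is the constant hidden in O(1/sqrt n). Under the constant mechanism p0
   the context (p0, r) consists of the rounds with r_t = r. *)
Definition no_secret_information U V (P0 : {fset P}) astar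
    (psi : dist R Y -> P) (K : R) (L : learner) y : Prop :=
  forall pis,
  let bounded ps p r :=
    let rs := recommendations astar ps pis in
    let n := context_count ps rs p r in
    (0 < n)%N ->
      secret_information U L y ps rs p r <= K / Num.sqrt n%:R /\
      secret_information V L y ps rs p r <= K / Num.sqrt n%:R in
  (forall p r, bounded (map_tuple psi pis) p r) /\
  (forall p0 r, p0 \in P0 -> bounded (constant_policies p0) p0 r).

Definition event_count pis (E : event) : nat := \sum_(t < T) E (tnth pis t).

Definition conditional_bias pis y (E : event) : R :=
  T%:R^-1 * \sum_(j : Y)
    `| \sum_(t < T) (E (tnth pis t))%:R *
         (tnth pis t j - (tnth y t == j)%:R) |.

Definition bias_rate (EE : set event) pis (E : event) : R :=
  let l := ln (#|Y| * cardinal EE * T)%N%:R in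
  #|Y|%:R * l / T%:R +
  #|Y|%:R * Num.sqrt (l * (event_count pis E)%:R) / T%:R.

Context (d : measure_display) (Omega : measurableType d).

(* A randomized forecasting algorithm: the forecast is a function of the
   internal randomness and of the past states. *)
Definition forecaster : Type := Omega -> seq Y -> dist R Y.

Definition forecasts (F : forecaster) y (w : Omega) : T.-tuple (dist R Y) :=
  [tuple F w (take t y) | t < T].

Definition measurable_forecaster (EE : set event) (F : forecaster) : Prop :=
  forall s : seq Y,
    (forall j, measurable_fun setT (fun w => F w s j)) /\
    (forall E, EE E -> measurable [set w | E (F w s)]).

(* The bias guarantee holds in expectation and simultaneously for all events:
   the maximum over the events is taken before the expectation. In particular
   E[bias E] <= K * E[rate E] for each single event E; that weaker form does
   not control quantities such as E[max_{p0} bias(E_{p0})], which matter here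
   because the regret takes its maximum inside the expectation too. *)
Definition unbiased_forecaster (Pr : probability Omega R) (EE : set event)
    (K : R) (F : forecaster) : Prop :=
  measurable_forecaster EE F /\
  forall y,
    (\int[Pr]_w (sup [set conditional_bias (forecasts F y w) y E -
                          K * bias_rate EE (forecasts F y w) E
                     | E in EE])%:E <= 0)%E.

Definition mechanism_policy_regret V (P0 : {fset P}) astar
    (Pr : probability Omega R) (F : forecaster) (psi : dist R Y -> P)
    (L : learner) y : \bar R :=
  (\int[Pr]_w (policy_regret V P0 astar psi (forecasts F y w) L y)%:E)%E.

End Interaction.
End Game.

(* Main.v *)
(* Group the rounds by context (p, r). Within a context let mu be the empirical
   distribution of the Agent's actions; by No Secret Information the actions can
   be replaced by mu, and by the bias guarantee for the event "the context is
   (p, r)" the states can be replaced by the forecasts. There r is optimal at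
   every round, so the swap regret towards r controls the average U-gap of mu.
   - Against the oracle, stability bounds the V-loss of an action by
     gamma + (2/beta) * (its U-gap).
   - Against a constant p0, an action that is not eps-optimal has U-gap above
     eps, so the V-gain of an action over aeps is at most (2/eps) * (its U-gap).
   Both are instances of [expected_regret], with W = V and W = - V, and
   optimality of the oracle compares the two forecast utilities up to c. The
   bound so obtained on the regret is, for each realization of the forecasts,
   affine in the largest excess of a bias over its rate, whose integral is
   nonpositive by assumption. When there are more oracle contexts than rounds the
   right-hand side exceeds the trivial bound 2, as beta <= beta_max. *)

Require Import Defs.
From HB Require Import structures.
From mathcomp Require Import all_boot all_order all_algebra.
From mathcomp Require Import finmap.
From mathcomp Require Import all_classical all_reals all_analysis.
From mathcomp Require Import measurable_realfun zify ring lra.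
From Stdlib Require Import Lia.

Set Implicit Arguments.
Unset Strict Implicit.
Unset Printing Implicit Defensive.

Import Order.TTheory GRing.Theory Num.Theory.

Local Open Scope classical_set_scope.
Local Open Scope ring_scope.

(** * Probability masses and the law of the Agent's action sequence *)

Section Distributions.
Context (R : realType) (S : finType).
Implicit Types (mu : dist R S).

Lemma mass_ge0 mu s : 0 <= mu s.
Proof. by case: mu => m /= /andP[/forallP]. Qed.

Lemma mass_sum1 mu : \sum_s mu s = 1.
Proof. by case: mu => m /= /andP[_ /eqP]. Qed.

End Distributions.

Lemma sum_tuple_cons (R : nmodType) (A : finType) n (f : n.+1.-tuple A -> R) :
  \sum_(u : n.+1.-tuple A) f u =
  \sum_a \sum_(v : n.-tuple A) f [tuple of a :: v].
Proof.
rewrite pair_bigA /=.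
rewrite (reindex (fun x : A * n.-tuple A => [tuple of x.1 :: x.2])) //=.
exists (fun u : n.+1.-tuple A => (thead u, [tuple of behead u])) => [[a v] _|u _].
  by rewrite /= theadE; congr pair; apply: val_inj.
by rewrite /= -tuple_eta.
Qed.

(** Induction on the length: once the first action [a] is drawn, the rest follows a law of the same
    form with kernel [q (a :: _)]. *)
Lemma sum_path_law (R : realType) (A : finType) n (q : seq A -> dist R A) :
  \sum_(u : n.-tuple A) \prod_(t < n) q (take t u) (tnth u t) = 1.
Proof.
elim: n q => [|n IH] q.
  rewrite (bigD1 [tuple]) //= big_ord0 big1 ?addr0 // => u /eqP[].
  exact: tuple0.
rewrite sum_tuple_cons -[RHS](mass_sum1 (q [::])); apply: eq_bigr => a _.
transitivity (\sum_(v : n.-tuple A)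
    q [::] a * \prod_(t < n) q (a :: take t v) (tnth v t)).
  apply: eq_bigr => v _; rewrite big_ord_recl (tnth_nth a) /=; congr (_ * _).
  by apply: eq_bigr => t _; rewrite !(tnth_nth a).
by rewrite -mulr_sumr (IH (fun s => q (a :: s))) mulr1.
Qed.

Section ExpectActions.
Context (R : realType) (Y A : finType) (P : choiceType) (T : nat).
Context (L : learner R Y A P) (y : T.-tuple Y) (ps : T.-tuple P) (rs : T.-tuple A).
Implicit Types (f g : T.-tuple A -> R).

Lemma action_law_ge0 acts : 0 <= action_law L y ps rs acts.
Proof. by apply: prodr_ge0 => t _; exact: mass_ge0. Qed.

Lemma action_law_sum1 : \sum_acts action_law L y ps rs acts = 1.
Proof.
(* The round is read off as the length of the action history, which makes the learner a kernel in
   that history alone. *)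
rewrite -[RHS](sum_path_law T (fun s => L (take (size s) y) s
  (take (size s).+1 rs) (take (size s).+1 ps))).
apply: eq_bigr => u _; apply: eq_bigr => t _.
by rewrite size_takel // size_tuple ltnW.
Qed.

Lemma expect_cst c : expect_actions L y ps rs (fun=> c) = c.
Proof. by rewrite /expect_actions -mulr_suml action_law_sum1 mul1r. Qed.

Lemma le_expect f g : (forall acts, f acts <= g acts) ->
  expect_actions L y ps rs f <= expect_actions L y ps rs g.
Proof.
by move=> fg; apply: ler_sum => u _; rewrite ler_wpM2l ?action_law_ge0.
Qed.

Lemma expectD f g : expect_actions L y ps rs (fun u => f u + g u) =
  expect_actions L y ps rs f + expect_actions L y ps rs g.
Proof. by rewrite -big_split; apply: eq_bigr => u _; rewrite mulrDr. Qed.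

Lemma expectZ c f : expect_actions L y ps rs (fun u => c * f u) =
  c * expect_actions L y ps rs f.
Proof. by rewrite mulr_sumr; apply: eq_bigr => u _; rewrite mulrCA. Qed.

Lemma expect_sum (I : Type) (s : seq I) (f : I -> T.-tuple A -> R) :
  expect_actions L y ps rs (fun u => \sum_(i <- s) f i u) =
  \sum_(i <- s) expect_actions L y ps rs (f i).
Proof.
by rewrite exchange_big; apply: eq_bigr => u _; rewrite mulr_sumr.
Qed.

End ExpectActions.

(** * Regret within a single context *)

Section ContextRegret.
Context (R : realType) (Y A : finType) (P : choiceType) (T : nat).
Context (pis : T.-tuple (dist R Y)) (y : T.-tuple Y).
Implicit Types (I : pred 'I_T) (u U W : A -> P -> Y -> R).

(** The bias before division by [T], indexed by a set of rounds rather than an event so that it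
    applies to contexts. *)
Definition drift I : R :=
  \sum_(j : Y) `|\sum_(t < T | I t) (tnth pis t j - (tnth y t == j)%:R)|.

Lemma drift_ge0 I : 0 <= drift I.
Proof. exact: sumr_ge0. Qed.

Lemma conditional_biasE (E : event R Y) :
  conditional_bias pis y E = T%:R^-1 * drift (fun t => E (tnth pis t)).
Proof.
congr (_ * _); apply: eq_bigr => j _; congr `|_|; rewrite [RHS]big_mkcond.
by apply: eq_bigr => t _; case: (E _); rewrite ?mul1r ?mul0r.
Qed.

(** The difference pairs [v] with the accumulated forecast error: duality of the l1 and sup
    norms. *)
Lemma drift_transfer I (v : Y -> R) : (forall j, `|v j| <= 1) ->
  `|\sum_(t < T | I t) (\sum_j tnth pis t j * v j) -
    \sum_(t < T | I t) v (tnth y t)| <= drift I.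
Proof.
move=> v1; rewrite -sumrB.
rewrite (eq_bigr (fun t => \sum_j (tnth pis t j - (tnth y t == j)%:R) * v j)).
  rewrite exchange_big /=; apply: le_trans (ler_norm_sum _ _ _) _.
  apply: ler_sum => j _; rewrite -mulr_suml normrM.
  by rewrite ler_piMr // normr_ge0.
move=> t _; under [RHS]eq_bigr do rewrite mulrBl.
rewrite sumrB; congr (_ - _); rewrite (bigD1 (tnth y t)) //= eqxx mul1r.
by rewrite big1 ?addr0 // => j /negPf; rewrite eq_sym => ->; rewrite mul0r.
Qed.

Lemma util_state_mix u (mu : A -> R) p (pi : dist R Y) :
  \sum_j pi j * util_mix u mu p j = \sum_a mu a * util_state u a p pi.
Proof.
under eq_bigr do rewrite mulr_sumr.
rewrite exchange_big; apply: eq_bigr => a _; rewrite mulr_sumr.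
by apply: eq_bigr => j _; rewrite mulrCA.
Qed.

Lemma util_mix_norm u (mu : A -> R) p j :
  (forall a, 0 <= mu a) -> \sum_a mu a = 1 -> (forall a p s, `|u a p s| <= 1) ->
  `|util_mix u mu p j| <= 1.
Proof.
move=> mu0 mu1 u1; apply: le_trans (ler_norm_sum _ _ _) _.
rewrite -mu1; apply: ler_sum => a _.
by rewrite normrM ger0_norm // ler_piMr.
Qed.

Context (ps : T.-tuple P) (rs acts : T.-tuple A).

Definition secret_gap u p r : R :=
  `|\sum_(t < T | in_context ps rs p r t)
      (u (tnth acts t) p (tnth y t) -
       util_mix u (empirical_actions R ps rs acts p r) p (tnth y t))|.

Lemma context_count_eq0 p r t :
  context_count ps rs p r = 0%N -> in_context ps rs p r t = false.
Proof.
move=> /eqP; rewrite /context_count sum_nat_eq0 => /forallP /(_ t).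
by case: in_context.
Qed.

Lemma sum_context_cst p r (g : R) :
  \sum_(t < T | in_context ps rs p r t) g = g * (context_count ps rs p r)%:R.
Proof.
rewrite big_mkcond natr_sum mulr_sumr; apply: eq_bigr => t _.
by case: ifP; rewrite ?mulr1 ?mulr0.
Qed.

Lemma empirical_actions_ge0 p r a : 0 <= empirical_actions R ps rs acts p r a.
Proof. by apply: mulr_ge0; [rewrite invr_ge0|apply: sumr_ge0]. Qed.

Lemma empirical_actions_sum1 p r : (0 < context_count ps rs p r)%N ->
  \sum_a empirical_actions R ps rs acts p r a = 1.
Proof.
move=> n0; rewrite -mulr_sumr exchange_big /=.
under eq_bigr => t _.
  rewrite (bigD1 (tnth acts t)) //= eqxx big1 ?addr0; last first.
    by move=> a /negPf; rewrite eq_sym => ->.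
  over.
by rewrite sum_context_cst mul1r mulVf // pnatr_eq0 -lt0n.
Qed.

(** [w] is a reference payoff. Averaging the affine hypothesis over the empirical mixture bounds the
    loss in terms of forecasts. Returning to the states costs one drift each for [r] under [U], the
    mixture under [U] and the mixture under [W]; returning from the mixture to the actions costs one
    [secret_gap] per utility. *)
Lemma context_regret U W (w : 'I_T -> R) (g k : R) p r : 0 <= k ->
  (forall a p s, `|U a p s| <= 1) -> (forall a p s, `|W a p s| <= 1) ->
  (forall t a, in_context ps rs p r t ->
     w t - util_state W a p (tnth pis t) <=
     g + k * (util_state U r p (tnth pis t) - util_state U a p (tnth pis t))) ->
  \sum_(t < T | in_context ps rs p r t) (w t - W (tnth acts t) p (tnth y t)) <=
  g * (context_count ps rs p r)%:R +
  k * (\sum_(t < T | in_context ps rs p r t)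
         (U r p (tnth y t) - U (tnth acts t) p (tnth y t)) +
       secret_gap U p r + 2 * drift (in_context ps rs p r)) +
  secret_gap W p r + drift (in_context ps rs p r).
Proof.
move=> k0 U1 W1 Hw; have D0 := drift_ge0 (in_context ps rs p r).
(* In an empty context the empirical weights all vanish and do not form a distribution. *)
have [n0|n0] := posnP (context_count ps rs p r).
  rewrite !big_pred0 => [|t|t]; try exact: context_count_eq0.
  rewrite n0 mulr0 /secret_gap !big_pred0 => [|t|t]; try exact: context_count_eq0.
  by rewrite !normr0 !addr0 !add0r addr_ge0 // mulr_ge0 // mulr_ge0.
set I := in_context ps rs p r in D0 *.
set mu := empirical_actions R ps rs acts p r.
have mu0 a : 0 <= mu a by exact: empirical_actions_ge0.
have mu1 : \sum_a mu a = 1 by exact: empirical_actions_sum1.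
have DU := drift_transfer I (fun j => util_mix_norm p j mu0 mu1 U1).
have DW := drift_transfer I (fun j => util_mix_norm p j mu0 mu1 W1).
have Dr := drift_transfer I (U1 r p).
(* Naming the absolute values inside [secret_gap] allows the sums under them to be split. *)
have GU : `|_| = secret_gap U p r := erefl.
have GW : `|_| = secret_gap W p r := erefl.
rewrite sumrB -/mu -/I in GU; rewrite sumrB -/mu -/I in GW.
have Hmix : \sum_(t < T | I t) w t -
    \sum_(t < T | I t) \sum_j tnth pis t j * util_mix W mu p j <=
    g * (context_count ps rs p r)%:R +
    k * (\sum_(t < T | I t) \sum_j tnth pis t j * U r p j -
         \sum_(t < T | I t) \sum_j tnth pis t j * util_mix U mu p j).
  rewrite -sum_context_cst -!sumrB mulr_sumr -big_split; apply: ler_sum => t It.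
  (* Every term receives total weight [\sum_a mu a = 1], so that the hypothesis applies action by
     action. *)
  rewrite !util_state_mix -[w t]mul1r -[g]mul1r.
  rewrite -[\sum_(j : Y) _ * U _ _ _]mul1r -mu1 !mulr_suml -!sumrB mulr_sumr.
  rewrite -big_split; apply: ler_sum => a _ /=.
  by have := ler_wpM2l (mu0 a) (Hw t a It); rewrite /util_state; lra.
rewrite !sumrB -/I.
move: DU DW Dr; rewrite !ler_norml => /andP[DU _] /andP[_ DW] /andP[_ Dr].
have := ler_norm (\sum_(t < T | I t) U (tnth acts t) p (tnth y t) -
  \sum_(t < T | I t) util_mix U mu p (tnth y t)).
have := lerNnormlW (lexx `|\sum_(t < T | I t) W (tnth acts t) p (tnth y t) -
  \sum_(t < T | I t) util_mix W mu p (tnth y t)|).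
rewrite GU GW => SW SU.
set a1 := \sum_(t < T | I t) \sum_j tnth pis t j * U r p j in Hmix Dr.
set a2 := \sum_(t < T | I t) \sum_j tnth pis t j * util_mix U mu p j in Hmix DU.
set Q := (X in k * X); have : a1 - a2 <= Q by rewrite /Q; lra.
by move=> /(ler_wpM2l k0) ?; lra.
Qed.

End ContextRegret.

(** Cauchy-Schwarz, by induction: after squaring, the step is the inequality of arithmetic and
    geometric means for [k * x i] and [S]. *)
Lemma sum_sqrt_le (R : realType) (I : Type) (s : seq I) (x : I -> R) :
  (forall i, 0 <= x i) ->
  \sum_(i <- s) Num.sqrt (x i) <=
  Num.sqrt ((size s)%:R * \sum_(i <- s) x i).
Proof.
move=> x0; elim: s => [|i s IH]; first by rewrite !big_nil sqrtr_ge0.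
rewrite !big_cons /=; apply: le_trans (lerD (lexx _) IH) _.
set S := \sum_(_ <- s) _; have S0 : 0 <= S by exact: sumr_ge0.
set k := (size s)%:R; have k0 : 0 <= k :> R by [].
rewrite -natr1 -/k -ler_sqr ?nnegrE ?addr_ge0 ?sqrtr_ge0 //.
rewrite sqrrD !sqr_sqrtr ?mulr_ge0 ?addr_ge0 //.
suff : 2 * (Num.sqrt (x i) * Num.sqrt (k * S)) <= k * x i + S.
  by rewrite -mulr_natl; lra.
rewrite mulrC -ler_pdivlMr // -ler_sqr ?nnegrE ?mulr_ge0 ?sqrtr_ge0 //; last first.
  by rewrite ?invr_ge0 ?addr_ge0 ?mulr_ge0.
rewrite exprMn !sqr_sqrtr ?mulr_ge0 //.
have := sqr_ge0 (k * x i - S); rewrite /=.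
by nra.
Qed.

(** * Swap regret as a supremum over action maps *)

Section SwapRegret.
Context (R : realType) (Y A : finType) (P : choiceType) (T : nat).
Context (U : A -> P -> Y -> R) (U1 : forall a p s, `|U a p s| <= 1).
Context (y : T.-tuple Y) (ps : T.-tuple P) (rs acts : T.-tuple A).
Hypothesis T0 : (0 < T)%N.

Lemma swap_regret_ub (h : P * A * A -> A) :
  T%:R^-1 * \sum_(t < T)
    (U (h (tnth ps t, tnth rs t, tnth acts t)) (tnth ps t) (tnth y t) -
     U (tnth acts t) (tnth ps t) (tnth y t)) <= swap_regret U y ps rs acts.
Proof.
apply: ub_le_sup; last by exists h.
exists 2 => _ [h' _ <-]; rewrite mulrC ler_pdivrMr ?ltr0n //.
rewrite mulr_natr -[in leRHS](card_ord T) -sumr_const; apply: ler_sum => t _.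
have /ler_normlP[_] :=
  U1 (h' (tnth ps t, tnth rs t, tnth acts t)) (tnth ps t) (tnth y t).
by have /ler_normlP[] := U1 (tnth acts t) (tnth ps t) (tnth y t); lra.
Qed.

Lemma swap_regret_ge0 : 0 <= swap_regret U y ps rs acts.
Proof.
(* The map [snd] keeps the action that was played and has zero regret. *)
apply: le_trans (swap_regret_ub snd); rewrite big1 ?mulr0 // => t _.
exact: subrr.
Qed.

End SwapRegret.

(** * Summation over contexts and expectation over actions *)

Section ExpectedRegret.
Context (R : realType) (Y A : finType) (P : choiceType) (T : nat).
Context (pis : T.-tuple (dist R Y)) (y : T.-tuple Y) (L : learner R Y A P).
Context (ps : T.-tuple P) (rs : T.-tuple A) (C : seq (P * A)).
Implicit Types (u U W : A -> P -> Y -> R).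
Hypothesis T0 : (0 < T)%N.
Hypothesis C_uniq : uniq C.
Hypothesis C_all : forall t, (tnth ps t, tnth rs t) \in C.

(** Each round belongs to exactly one context of the duplicate-free list [C]. *)
Lemma sum_contexts (f : 'I_T -> R) :
  \sum_(t < T) f t =
  \sum_(c <- C) \sum_(t < T | in_context ps rs c.1 c.2 t) f t.
Proof.
under [RHS]eq_bigr do rewrite big_mkcond.
rewrite exchange_big; apply: eq_bigr => t _ /=.
rewrite (bigD1_seq _ (C_all t) C_uniq) /= {1}/in_context eqxx.
rewrite big1 ?addr0 // => -[p r] /= /negPf ctx.
by rewrite /in_context eq_sym ctx.
Qed.

Lemma sum_context_count :
  \sum_(c <- C) (context_count ps rs c.1 c.2)%:R = T%:R :> R.
Proof.
transitivity (\sum_(t < T) 1 : R); last by rewrite sumr_const card_ord.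
by rewrite sum_contexts; apply: eq_bigr => c _; rewrite sum_context_cst mul1r.
Qed.

(** Multiplication by the count [n] turns K / sqrt n into K sqrt n, a form that also holds for empty
    contexts. *)
Lemma expect_secret_gap u (K : R) p r : 0 <= K ->
  ((0 < context_count ps rs p r)%N -> secret_information u L y ps rs p r <=
    K / Num.sqrt (context_count ps rs p r)%:R) ->
  expect_actions L y ps rs (fun acts => secret_gap y ps rs acts u p r) <=
  K * Num.sqrt (context_count ps rs p r)%:R.
Proof.
move=> K0; have [n0 _|n0 /(_ isT)] := posnP (context_count ps rs p r).
  rewrite (_ : (fun _ => _) = fun=> 0) ?expect_cst; last first.
    apply/funext => acts; rewrite /secret_gap big_pred0 ?normr0 // => t.
    exact: context_count_eq0.
  by rewrite mulr_ge0 ?sqrtr_ge0.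
set s := Num.sqrt _; have s0 : 0 < s by rewrite sqrtr_gt0 ltr0n.
have ns : (context_count ps rs p r)%:R = s ^+ 2 by rewrite sqr_sqrtr.
rewrite /secret_information ns mulrC ler_pdivrMr ?exprn_gt0 //.
by rewrite -mulrA (_ : s^-1 * s ^+ 2 = s) // expr2 mulKf ?gt_eqF.
Qed.

(** Cauchy-Schwarz over the contexts, whose counts add up to [T]. *)
Lemma sum_expect_secret_gap u (K : R) : 0 <= K ->
  (forall p r, (0 < context_count ps rs p r)%N ->
    secret_information u L y ps rs p r <=
    K / Num.sqrt (context_count ps rs p r)%:R) ->
  T%:R^-1 * \sum_(c <- C)
    expect_actions L y ps rs (fun acts => secret_gap y ps rs acts u c.1 c.2) <=
  K * Num.sqrt ((size C)%:R / T%:R).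
Proof.
move=> K0 HK; have TR : 0 < T%:R :> R by rewrite ltr0n.
rewrite mulrC ler_pdivrMr //.
apply: (@le_trans _ _ (K * \sum_(c <- C) Num.sqrt (context_count ps rs c.1 c.2)%:R)).
  by rewrite mulr_sumr; apply: ler_sum => c _; exact: expect_secret_gap (HK _ _).
rewrite -mulrA ler_wpM2l //.
apply: le_trans (sum_sqrt_le _ _) _ => //; rewrite sum_context_count.
rewrite -{3}(ger0_norm (ltW TR)) -sqrtr_sqr -sqrtrM ?divr_ge0 //.
by rewrite expr2 mulrA divfK ?gt_eqF.
Qed.

(** [context_regret] is summed over [C] for each action sequence, and the expectation is taken
    last. *)
Lemma expected_regret U W (w : 'I_T -> R) (g k K eps_swap : R) :
  0 <= k -> 0 <= K ->
  (forall a p s, `|U a p s| <= 1) -> (forall a p s, `|W a p s| <= 1) ->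
  (forall t a, w t - util_state W a (tnth ps t) (tnth pis t) <=
     g + k * (util_state U (tnth rs t) (tnth ps t) (tnth pis t) -
              util_state U a (tnth ps t) (tnth pis t))) ->
  expect_actions L y ps rs (swap_regret U y ps rs) <= eps_swap ->
  (forall p r, (0 < context_count ps rs p r)%N ->
     secret_information U L y ps rs p r <=
       K / Num.sqrt (context_count ps rs p r)%:R /\
     secret_information W L y ps rs p r <=
       K / Num.sqrt (context_count ps rs p r)%:R) ->
  let B := T%:R^-1 * \sum_(c <- C) drift pis y (in_context ps rs c.1 c.2) in
  let S := K * Num.sqrt ((size C)%:R / T%:R) in
  (expect_actions L y ps rs (fun acts => T%:R^-1 * \sum_(t < T)
    (w t - W (tnth acts t) (tnth ps t) (tnth y t))) <=
  g + k * (eps_swap + S + 2 * B) + S + B : Prop).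
Proof.
move=> k0 K0 U1 W1 Hw Hswap Hsecret B S.
have TR : 0 < T%:R :> R by rewrite ltr0n.
set sumS := fun u acts => \sum_(c <- C) secret_gap y ps rs acts u c.1 c.2.
have path acts : T%:R^-1 * \sum_(t < T)
    (w t - W (tnth acts t) (tnth ps t) (tnth y t)) <=
    (g + k * (2 * B) + B) + (k * swap_regret U y ps rs acts +
      (k * (T%:R^-1 * sumS U acts) + T%:R^-1 * sumS W acts)).
  (* This map swaps each action for the recommendation, so the swap regret bounds the total
     U-gap. *)
  have swap := swap_regret_ub U1 y ps rs acts T0 (fun x => x.1.2).
  rewrite /= sum_contexts in swap; rewrite sum_contexts.
  set lhs := \sum_(c <- C) _ in swap *.
  set rhs := \sum_(c <- C) _; suff : rhs <= g * T%:R +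
      k * (lhs + sumS U acts + 2 * (T%:R * B)) + sumS W acts + T%:R * B.
    move=> rhs_le; rewrite mulrC ler_pdivrMr //.
    have -> : (g + k * (2 * B) + B + (k * swap_regret U y ps rs acts +
        (k * (T%:R^-1 * sumS U acts) + T%:R^-1 * sumS W acts))) * T%:R =
      g * T%:R + k * (swap_regret U y ps rs acts * T%:R + sumS U acts +
        2 * (T%:R * B)) + sumS W acts + T%:R * B by field; rewrite gt_eqF.
    apply: le_trans rhs_le _; rewrite !lerD2r lerD2l ler_wpM2l // !lerD2r.
    by move: swap; rewrite mulrC ler_pdivrMr.
  have -> : T%:R * B = \sum_(c <- C) drift pis y (in_context ps rs c.1 c.2).
    by rewrite mulrA divff ?mul1r // gt_eqF.
  rewrite -sum_context_count /rhs /lhs /sumS !mulr_sumr -!big_split mulr_sumr.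
  rewrite -!big_split; apply: ler_sum => -[p r] _ /=.
  have eqI u (a : 'I_T -> A) :
      \sum_(t < T | in_context ps rs p r t) u (a t) (tnth ps t) (tnth y t) =
      \sum_(t < T | in_context ps rs p r t) u (a t) p (tnth y t).
    by apply: eq_bigr => t /eqP[->].
  have eqr : \sum_(t < T | in_context ps rs p r t)
        U (tnth rs t) (tnth ps t) (tnth y t) =
      \sum_(t < T | in_context ps rs p r t) U r p (tnth y t).
    by apply: eq_bigr => t /eqP[-> ->].
  have := context_regret (pis := pis) y acts k0 U1 W1 (w := w) (g := g)
    (ps := ps) (rs := rs) (p := p) (r := r).
  rewrite !sumrB eqr !eqI; apply => t a /eqP[tp tr].
  by have := Hw t a; rewrite tp tr.
apply: le_trans (le_expect L y ps rs path) _.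
rewrite expectD expect_cst !expectD !expectZ !expect_sum.
have SU := sum_expect_secret_gap K0 (fun p r n0 => (Hsecret p r n0).1).
have SW := sum_expect_secret_gap K0 (fun p r n0 => (Hsecret p r n0).2).
by have := ler_wpM2l k0 SU; have := ler_wpM2l k0 Hswap; rewrite -/S in SU SW *; lra.
Qed.

End ExpectedRegret.

(** * Forecasting bias and its rate *)

Lemma ln_nat_ge0 (R : realType) n : 0 <= ln n%:R :> R.
Proof.
by case: n => [|n]; [rewrite ln0|rewrite ln_ge0 // ler1n].
Qed.

Section Bias.
Context (R : realType) (Y A : finType) (P : choiceType) (T : nat).
Context (pis : T.-tuple (dist R Y)) (y : T.-tuple Y).
Context (EE : set (event R Y)) (K : R).
Hypotheses (T0 : (0 < T)%N) (K0 : 0 <= K).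

Lemma conditional_bias_ge0 E : 0 <= conditional_bias pis y E.
Proof. by rewrite conditional_biasE mulr_ge0 ?invr_ge0 ?drift_ge0. Qed.

Lemma conditional_bias_le2 E : conditional_bias pis y E <= 2.
Proof.
rewrite conditional_biasE mulrC ler_pdivrMr ?ltr0n //.
apply: (@le_trans _ _ (\sum_j \sum_(t < T) (tnth pis t j + (tnth y t == j)%:R))).
  apply: ler_sum => j _; apply: le_trans (ler_norm_sum _ _ _) _.
  rewrite big_mkcond; apply: ler_sum => t _; have m0 := mass_ge0 (tnth pis t) j.
  case: ifP => _; last by rewrite addr_ge0.
  by apply: le_trans (ler_normB _ _) _; rewrite !ger0_norm.
rewrite exchange_big /= mulr_natr -[in leRHS](card_ord T) -sumr_const.
apply: ler_sum => t _; rewrite big_split /= mass_sum1 (bigD1 (tnth y t)) //= eqxx.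
by rewrite big1 ?addr0 // => j /negPf; rewrite eq_sym => ->.
Qed.

Lemma bias_rate_ge0 E : 0 <= bias_rate EE pis E.
Proof.
by rewrite /bias_rate addr_ge0 // !mulr_ge0 ?invr_ge0 ?sqrtr_ge0 ?ln_nat_ge0.
Qed.

(** The integrand of [unbiased_forecaster]: one random number that controls all events
    simultaneously. *)
Definition excess_bias : R :=
  sup [set conditional_bias pis y E - K * bias_rate EE pis E | E in EE].

Lemma excess_bias_has_ubound :
  has_ubound [set conditional_bias pis y E - K * bias_rate EE pis E | E in EE].
Proof.
exists 2 => _ [E _ <-]; apply: le_trans (conditional_bias_le2 E).
by rewrite gerBl mulr_ge0 ?bias_rate_ge0.
Qed.

Lemma conditional_bias_le E : EE E ->
  conditional_bias pis y E <= excess_bias + K * bias_rate EE pis E.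
Proof.
move=> EEE; rewrite -lerBlDr; apply: ub_le_sup; last by exists E.
exact: excess_bias_has_ubound.
Qed.

(** [ev] realizes each context as an event, which contributes the common excess and its own rate.
    The linear parts of the rates add up; the square-root parts combine by Cauchy-Schwarz. *)
Lemma sum_drift_le (ps : T.-tuple P) (rs : T.-tuple A) (C : seq (P * A))
    (ev : P * A -> event R Y) :
  uniq C -> (forall t, (tnth ps t, tnth rs t) \in C) ->
  (forall c, c \in C -> EE (ev c)) ->
  (forall c t, c \in C -> ev c (tnth pis t) = in_context ps rs c.1 c.2 t) ->
  let l := ln (#|Y| * cardinal EE * T)%N%:R in
  (T%:R^-1 * \sum_(c <- C) drift pis y (in_context ps rs c.1 c.2) <=
  (size C)%:R * excess_bias +
  K * (#|Y|%:R * (l * ((size C)%:R / T%:R) +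
                  Num.sqrt l * Num.sqrt ((size C)%:R / T%:R))) : Prop).
Proof.
move=> C_uniq C_all EC evC l; have TR : 0 < T%:R :> R by rewrite ltr0n.
pose n c := (context_count ps rs c.1 c.2)%:R : R.
have -> : T%:R^-1 * \sum_(c <- C) drift pis y (in_context ps rs c.1 c.2) =
    \sum_(c <- C) conditional_bias pis y (ev c).
  rewrite mulr_sumr; apply: eq_big_seq => c cC; rewrite conditional_biasE.
  congr (_ * drift _ _ _); apply/funext => t; exact/esym/evC.
apply: (@le_trans _ _ (\sum_(c <- C) (excess_bias +
    K * (#|Y|%:R * (l / T%:R + Num.sqrt l / T%:R * Num.sqrt (n c)))))).
  rewrite !big_seq; apply: ler_sum => c cC.
  apply: le_trans (conditional_bias_le (EC c cC)) _.
  rewrite lerD2l ler_wpM2l // /bias_rate -/l.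
  have -> : event_count pis (ev c) = context_count ps rs c.1 c.2.
    by apply: eq_bigr => t _; rewrite evC.
  by rewrite sqrtrM ?ln_nat_ge0 // -/(n c); lra.
rewrite big_split /= big_const_seq count_predT iter_addr_0.
rewrite -[excess_bias *+ _]mulr_natl lerD2l.
rewrite -mulr_sumr ler_wpM2l // -mulr_sumr ler_wpM2l // big_split /=.
rewrite big_const_seq count_predT iter_addr_0.
rewrite -[_ / _ *+ _]mulr_natl mulrCA lerD2l -mulr_sumr.
rewrite -mulrA ler_wpM2l ?sqrtr_ge0 // mulrC ler_pdivrMr //.
apply: le_trans (sum_sqrt_le _ _) _ => //; rewrite sum_context_count //.
rewrite -{3}(ger0_norm (ltW TR)) -sqrtr_sqr -sqrtrM ?divr_ge0 //.
by rewrite expr2 mulrA divfK ?gt_eqF.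
Qed.

End Bias.

(** * Bounds and sign changes of utilities *)

Section UtilState.
Context (R : realType) (Y A : finType) (P : choiceType).
Implicit Types (u : A -> P -> Y -> R).

Lemma util_state_norm u a p pi : (forall a p s, `|u a p s| <= 1) ->
  `|util_state u a p pi| <= 1.
Proof.
move=> u1; apply: le_trans (ler_norm_sum _ _ _) _.
rewrite -(mass_sum1 pi); apply: ler_sum => j _.
by rewrite normrM ger0_norm ?mass_ge0 // ler_piMr ?mass_ge0.
Qed.

Lemma util_state_diff u a b p pi : (forall a p s, `|u a p s| <= 1) ->
  util_state u a p pi - util_state u b p pi <= 2.
Proof.
move=> u1; have := util_state_norm a p pi u1; have := util_state_norm b p pi u1.
by rewrite !ler_norml => /andP[? _] /andP[_ ?]; lra.
Qed.

Lemma util_stateN u a p pi :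
  util_state (fun a p s => - u a p s) a p pi = - util_state u a p pi.
Proof. by rewrite /util_state -sumrN; apply: eq_bigr => j _; rewrite mulrN. Qed.

(** The absolute value hides the sign, so the assumption on [V] also serves [- V]. *)
Lemma secret_informationN (T : nat) u (L : learner R Y A P) (y : T.-tuple Y) ps rs p r :
  secret_information (fun a p s => - u a p s) L y ps rs p r =
  secret_information u L y ps rs p r.
Proof.
congr (_ * expect_actions _ _ _ _ _); apply/funext => acts.
rewrite -normrN -sumrN; congr `|_|; apply: eq_bigr => t _.
rewrite opprB opprK addrC /util_mix -sumrN; congr (_ + _).
by apply: eq_bigr => a _; rewrite mulrN.
Qed.

End UtilState.

(** Any utility difference is at most 2, so a gap of at least [d] charged at slope 2 / d pays for
    it. *)
Lemma div_mul_ge2 (R : realType) (d x : R) : 0 < d -> d <= x -> 2 <= 2 / d * x.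
Proof. by move=> d0 dx; rewrite -mulrA ler_peMr // mulrC ler_pdivlMr ?mul1r. Qed.

Lemma regret_bound_mono (R : realType) (x x' s b b' k g : R) :
  0 <= k -> b <= b' -> x <= g + k * (s + 2 * b) + x' + b ->
  x <= g + (k * (s + 2 * b') + x' + b').
Proof. by move=> k0 bb'; have := ler_wpM2l k0 bb'; lra. Qed.

(** * Regret for fixed forecasts: the oracle against the benchmarks *)

Section Regret.
Context (R : realType) (Y A : finType) (P : choiceType) (P0 : {fset P}).
Context (U V : A -> P -> Y -> R).
Context (astar aeps : P -> dist R Y -> A) (popt oracle : dist R Y -> P).
Context (c eps beta gamma eps_swap Kf Ks : R) (T : nat) (y : T.-tuple Y).
Context (L : learner R Y A P).
Hypotheses (U1 : forall a p s, `|U a p s| <= 1).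
Hypotheses (V1 : forall a p s, `|V a p s| <= 1).
Hypotheses (T0 : (0 < T)%N).
Hypotheses (eps0 : 0 < eps) (beta0 : 0 < beta) (gamma0 : 0 <= gamma).
Hypotheses (Kf0 : 0 <= Kf) (Ks0 : 0 <= Ks).
Hypothesis astarP : is_astar U V astar.
Hypothesis aepsP : is_astar_eps U V astar eps aeps.
Hypothesis poptP : is_popt V P0 aeps popt.
Hypothesis oracleP : optimal_stable_oracle U V P0 astar aeps c beta gamma oracle.
Hypothesis oracle_fin : finite_set (range oracle).
Hypothesis secretP : no_secret_information U V P0 astar oracle Ks L y.

Lemma gap_ge0 p pi a :
  0 <= util_state U (astar p pi) p pi - util_state U a p pi.
Proof. by rewrite subr_ge0; exact: (astarP p pi).1. Qed.

(** Either [a] is the recommendation, or its U-gap is at least [beta] and pays for any V-loss, or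
    stability caps the loss at [gamma]. *)
Lemma stable_gap pi a :
  util_state V (astar (oracle pi) pi) (oracle pi) pi - util_state V a (oracle pi) pi <=
  gamma + 2 / beta * (util_state U (astar (oracle pi) pi) (oracle pi) pi -
                      util_state U a (oracle pi) pi).
Proof.
set p := oracle pi; have g0 := gap_ge0 p pi a.
have k0 : 0 <= 2 / beta by rewrite divr_ge0 ?ltW.
have h0 := mulr_ge0 k0 g0.
have [->|/((oracleP pi).1 a) [Ua|Va]] := eqVneq a (astar p pi).
- by rewrite !subrr mulr0 addr0.
- have /(div_mul_ge2 beta0) :
      beta <= util_state U (astar p pi) p pi - util_state U a p pi.
    by rewrite -/p in Ua; lra.
  by move=> /(le_trans (util_state_diff (astar p pi) a p pi V1)) /ler_wpDl; exact.
- by rewrite -/p in Va; lra.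
Qed.

(** [aeps] is V-best among the eps-optimal actions; the U-gap of any other action pays for its
    V-gain. *)
Lemma near_optimal_gap p0 pi a :
  util_state V a p0 pi - util_state V (aeps p0 pi) p0 pi <=
  2 / eps * (util_state U (astar p0 pi) p0 pi - util_state U a p0 pi).
Proof.
have g0 := gap_ge0 p0 pi a; have k0 : 0 <= 2 / eps by rewrite divr_ge0 ?ltW.
have h0 := mulr_ge0 k0 g0.
have [Ua|/ltW Ua] :=
  leP (util_state U (astar p0 pi) p0 pi - eps) (util_state U a p0 pi).
  by have := (aepsP p0 pi).2 a Ua; lra.
have /(div_mul_ge2 eps0) :
    eps <= util_state U (astar p0 pi) p0 pi - util_state U a p0 pi.
  by lra.
by have := util_state_diff a (aeps p0 pi) p0 pi V1; lra.
Qed.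

Let EE := all_events P0 astar aeps popt oracle.
Let l : R := ln (#|Y| * cardinal EE * T)%N%:R.

(** The error of a comparison with [m] contexts and slope 2 / delta. [B] is the bound of
    [sum_drift_le] on the average drift, which makes the whole affine in the excess bias [X]. *)
Definition context_error (m : nat) (delta X : R) : R :=
  let x := m%:R / T%:R in
  let B := m%:R * X + Kf * (#|Y|%:R * (l * x + Num.sqrt l * Num.sqrt x)) in
  2 / delta * (eps_swap + Ks * Num.sqrt x + 2 * B) + Ks * Num.sqrt x + B.

Context (pis : T.-tuple (dist R Y)).
Hypothesis swapP : no_contextual_swap_regret U P0 astar oracle eps_swap L y pis.

(** [expected_regret] with [W] = [V], the forecast value of the recommendation as reference, g =
    gamma and k = 2 / beta. *)
Lemma oracle_regret :
  let ps := map_tuple oracle pis in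
  let rs := recommendations astar ps pis in
  (expect_actions L y ps rs (fun acts => T%:R^-1 * \sum_(t < T)
    (util_state V (tnth rs t) (tnth ps t) (tnth pis t) -
     V (tnth acts t) (tnth ps t) (tnth y t))) <=
  gamma + context_error (cardinal (range oracle) * #|A|) beta
            (excess_bias pis y EE Kf) : Prop).
Proof.
move=> ps rs; pose C := [seq (p, r) | p <- fset_set (range oracle), r <- enum A].
have k0 : 0 <= 2 / beta by rewrite divr_ge0 ?ltW.
have sizeC : size C = (cardinal (range oracle) * #|A|)%N.
  by rewrite size_allpairs -cardE.
have C_uniq : uniq C.
  by apply: allpairs_uniq; [exact: fset_uniq|exact: enum_uniq|move=> [? ?] [? ?]].
have C_all t : (tnth ps t, tnth rs t) \in C.
  apply/allpairs_f; rewrite ?mem_enum // in_fset_set // tnth_map.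
  by apply/mem_set; exists (tnth pis t).
rewrite /context_error -sizeC.
apply: (regret_bound_mono k0); last first.
  apply: (expected_regret T0 C_uniq C_all k0 Ks0 U1 V1).
  + move=> t a; rewrite tnth_mktuple tnth_map; exact: stable_gap.
  + exact: swapP.1.
  + by move=> p r n0; exact: (secretP pis).1.
(* The context of a round is a function of its forecast, hence an event of [events1]. *)
apply: (sum_drift_le y T0 Kf0
  (ev := fun c pi => (oracle pi, astar (oracle pi) pi) == c)) => //.
- move=> _ /allpairsP[[p r] /= [+ _ ->]].
  rewrite in_fset_set // => /set_mem pO; left; left; exists p, r; split => //.
- by move=> [p r] t _; rewrite /in_context tnth_map tnth_mktuple tnth_map.
Qed.

(** [expected_regret] with [W] = [- V], minus the forecast value of [aeps] as reference, g = 0 and k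
    = 2 / eps. As the policy is fixed, a context is just a recommendation, described by an event of
    [events3]. *)
Lemma benchmark_regret p0 : p0 \in P0 ->
  let ps := constant_policies T p0 in
  let rs := recommendations astar ps pis in
  (expect_actions L y ps rs (fun acts => T%:R^-1 * \sum_(t < T)
    (V (tnth acts t) p0 (tnth y t) -
     util_state V (aeps p0 (tnth pis t)) p0 (tnth pis t))) <=
  context_error #|A| eps (excess_bias pis y EE Kf) : Prop).
Proof.
move=> p0P ps rs; pose C := [seq (p0, r) | r <- enum A].
have k0 : 0 <= 2 / eps by rewrite divr_ge0 ?ltW.
have sizeC : size C = #|A| by rewrite size_map -cardE.
have C_uniq : uniq C by rewrite map_inj_uniq ?enum_uniq // => ? ? [].
have psE t : tnth ps t = p0 by rewrite tnth_mktuple.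
have C_all t : (tnth ps t, tnth rs t) \in C by rewrite psE map_f ?mem_enum.
have -> : (fun acts : T.-tuple A => T%:R^-1 * \sum_(t < T)
    (V (tnth acts t) p0 (tnth y t) -
     util_state V (aeps p0 (tnth pis t)) p0 (tnth pis t))) =
  (fun acts => T%:R^-1 * \sum_(t < T)
    (- util_state V (aeps p0 (tnth pis t)) p0 (tnth pis t) -
     - V (tnth acts t) (tnth ps t) (tnth y t))).
  apply/funext => acts; congr (_ * _); apply: eq_bigr => t _.
  by rewrite psE opprK addrC.
rewrite /context_error -sizeC -[leRHS]add0r.
apply: (regret_bound_mono k0); last first.
  apply: (expected_regret (W := fun a p s => - V a p s) T0 C_uniq C_all k0 Ks0 U1).
  + by move=> a p s; rewrite normrN.
  + move=> t a; rewrite util_stateN opprK addrC add0r psE tnth_mktuple psE.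
    exact: near_optimal_gap.
  + exact: swapP.2.
  + move=> p r n0; rewrite secret_informationN.
    have [pp0|pp0] := eqVneq p p0.
      by rewrite pp0 in n0 *; exact: (secretP pis).2.
    (* Contexts of a policy other than [p0] are empty. *)
    move: n0; rewrite /context_count big1 // => t _.
    by rewrite /in_context psE xpair_eqE eq_sym (negPf pp0).
- apply: (sum_drift_le y T0 Kf0 (ev := fun c pi => astar p0 pi == c.2)) => //.
  + by move=> _ /mapP[r _ ->]; right; exists p0, r.
  + move=> _ t /mapP[r _ ->]; rewrite /in_context psE tnth_mktuple psE.
    by rewrite xpair_eqE eqxx.
Qed.

Lemma P0_neq0 : P0 != fset0.
Proof.
by apply/fset0Pn; exists (popt (tnth pis (Ordinal T0))); exact: (poptP _).1.
Qed.

(** Linearity splits the nested expectation over both action sequences into a difference of two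
    separate ones. *)
Lemma policy_regret_le_sup (b : R) :
  (forall p0, p0 \in P0 ->
    let ps := map_tuple oracle pis in
    let ps0 := constant_policies T p0 in
    (expect_actions L y ps0 (recommendations astar ps0 pis) (fun acts =>
      T%:R^-1 * \sum_(t < T) V (tnth acts t) p0 (tnth y t)) -
    expect_actions L y ps (recommendations astar ps pis) (fun acts =>
      T%:R^-1 * \sum_(t < T) V (tnth acts t) (tnth ps t) (tnth y t)) <= b : Prop)) ->
  policy_regret V P0 astar oracle pis L y <= b.
Proof.
move=> Hb; apply: ge_sup => [|_ [p0 /= p0P <-]].
  by have /fset0Pn[p0 p0P] := P0_neq0; eexists; exists p0.
apply: le_trans (Hb p0 p0P) => /=.
set e0 := expect_actions L y (constant_policies T p0) _ _; set f := fun acts => _.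
set ps := map_tuple oracle pis; set rs := recommendations _ _ _.
rewrite (_ : f = fun acts => e0 + -1 * (T%:R^-1 * \sum_(t < T)
  V (tnth acts t) (tnth ps t) (tnth y t))).
  by rewrite expectD expect_cst expectZ mulN1r.
apply/funext => acts; rewrite /f -(expect_cst L y (constant_policies T p0)
  (recommendations astar (constant_policies T p0) pis) (-1 * _)) /e0 -expectD.
congr expect_actions; apply/funext => acts0.
by rewrite sumrB; ring.
Qed.

Lemma policy_regret_le2 : policy_regret V P0 astar oracle pis L y <= 2.
Proof.
apply: policy_regret_le_sup => p0 p0P ps ps0.
have avg (p : 'I_T -> P) (acts : T.-tuple A) :
    `|T%:R^-1 * \sum_(t < T) V (tnth acts t) (p t) (tnth y t)| <= 1.
  rewrite normrM ger0_norm ?invr_ge0 // mulrC ler_pdivrMr ?ltr0n // mul1r.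
  apply: le_trans (ler_norm_sum _ _ _) _.
  rewrite -[in leRHS](card_ord T) -sumr_const; exact: ler_sum.
rewrite -[2]/(1 + 1) lerD //.
  rewrite -[leRHS](expect_cst L y ps0 (recommendations astar ps0 pis)).
  apply: le_expect => acts; have := avg (fun=> p0) acts.
  by rewrite ler_norml => /andP[].
rewrite lerNl -[leLHS](expect_cst L y ps (recommendations astar ps pis)).
apply: le_expect => acts; have := avg (tnth ps) acts.
by rewrite ler_norml => /andP[].
Qed.

(** A chain from the benchmark's utility through the forecast values [v0] and [v] to the mechanism's
    utility: the outer links cost the context errors and [gamma], the middle one costs [c]. *)
Lemma policy_regret_le :
  policy_regret V P0 astar oracle pis L y <=
  c + gamma +
  context_error (cardinal (range oracle) * #|A|) beta (excess_bias pis y EE Kf) +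
  context_error #|A| eps (excess_bias pis y EE Kf).
Proof.
apply: policy_regret_le_sup => p0 p0P ps ps0.
have := oracle_regret; have := benchmark_regret p0P; rewrite /= -/ps -/ps0.
set rs := recommendations astar ps pis; set rs0 := recommendations astar ps0 pis.
set eA := context_error _ beta _; set eB := context_error _ eps _.
set v0 := T%:R^-1 * \sum_(t < T) util_state V (aeps p0 (tnth pis t)) p0 (tnth pis t).
set v := T%:R^-1 * \sum_(t < T) util_state V (tnth rs t) (tnth ps t) (tnth pis t).
have vv0 : v0 - c <= v.
  have TR : T%:R != 0 :> R by rewrite pnatr_eq0 -lt0n.
  rewrite /v0 /v lerBlDr -[c](mulKf TR) -mulrDr ler_wpM2l ?invr_ge0 // mulr_natl.
  rewrite -[X in c *+ X](card_ord T) -sumr_const -big_split.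
  apply: ler_sum => t _ /=.
  rewrite tnth_mktuple tnth_map -lerBlDr; exact: (oracleP _).2.
rewrite (_ : (fun acts => T%:R^-1 * \sum_(t < T) (V _ p0 _ - _)) = fun acts =>
   T%:R^-1 * \sum_(t < T) V (tnth acts t) p0 (tnth y t) + - v0); last first.
  by apply/funext => acts; rewrite sumrB mulrBr.
rewrite (_ : (fun acts => T%:R^-1 * \sum_(t < T) (util_state V _ _ _ - _)) =
   fun acts => v + -1 * (T%:R^-1 *
     \sum_(t < T) V (tnth acts t) (tnth ps t) (tnth y t))); last first.
  by apply/funext => acts; rewrite sumrB mulrBr mulN1r.
rewrite !expectD !expect_cst (expectZ _ _ _ _ (-1)); lra.
Qed.

End Regret.

(** * Integration over the forecaster's randomness *)

Section PointwiseIntegral.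
Import HBNNSimple.

(* No measurability is needed: the integral of a nonnegative function is a
   supremum over the simple functions below it. *)
Lemma le_integral_pointwise d (Omega : measurableType d) (R : realType)
    (mu : {measure set Omega -> \bar R}) (f g : Omega -> \bar R) :
  (forall w, f w <= g w)%E -> (\int[mu]_w f w <= \int[mu]_w g w)%E.
Proof.
move=> fg; rewrite /integral !patch_setT; apply: leeB; apply: ereal_sup_le => /=.
  move=> _ [h hf <-]; exists h => //= w.
  by apply: le_trans (hf w) _; apply: (@funepos_le _ _ setT) => [x _|]; rewrite ?inE.
move=> _ [h hf <-]; exists h => //= w.
by apply: le_trans (hf w) _; apply: (@funeneg_le _ _ setT) => [x _|]; rewrite ?inE.
Qed.

End PointwiseIntegral.

Lemma integral_affine_le d (Omega : measurableType d) (R : realType)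
    (Pr : probability Omega R) (X : Omega -> R) (a b : R) :
  Pr.-integrable setT (EFin \o X) -> 0 <= b ->
  (\int[Pr]_w (X w)%:E <= 0)%E -> (\int[Pr]_w (a + b * X w)%:E <= a%:E)%E.
Proof.
move=> iX b0 X0; under eq_integral do rewrite EFinD EFinM.
rewrite integralD //; [|exact: finite_measure_integrable_cst|exact: integrableZl].
have -> : (\int[Pr]_w a%:E = a%:E)%E.
  by rewrite integral_cst //= [X in (_ * X)%E]probability_setT mule1.
rewrite (integralZl measurableT iX).
by rewrite geeDl // mule_ge0_le0.
Qed.

(** * Measurability and integrability of the excess bias *)

Section ExcessBiasIntegral.
Context (R : realType) (Y : finType) (T : nat) (y : T.-tuple Y).
Context (d : measure_display) (Omega : measurableType d).
Context (F : forecaster R Y Omega) (EE : set (event R Y)) (K : R).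
Hypotheses (EE_fin : finite_set EE) (FM : measurable_forecaster EE F).

Lemma measurable_event E s : EE E ->
  measurable_fun setT (fun w => (E (F w s))%:R : R).
Proof.
move=> EEE; rewrite (_ : (fun _ => _) = \1_[set w | E (F w s)]).
  by apply: measurable_indic; exact: (FM s).2.
by apply/funext => w; rewrite indicE mem_setE.
Qed.

Lemma measurable_conditional_bias E : EE E ->
  measurable_fun setT (fun w => conditional_bias (forecasts F y w) y E).
Proof.
move=> EEE; apply: measurable_funM => //; apply: measurable_sum => j.
apply: measurableT_comp => //; apply: measurable_sum => t.
under eq_fun do rewrite tnth_mktuple.
apply: measurable_funM; first exact: measurable_event.
by apply: measurable_funB => //; exact: (FM _).1.
Qed.

Lemma measurable_bias_rate E : EE E ->
  measurable_fun setT (fun w => bias_rate EE (forecasts F y w) E).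
Proof.
move=> EEE; apply: measurable_funD => //; apply: measurable_funM => //.
apply: measurable_funM => //.
apply: (measurableT_comp (continuous_measurable_fun (@sqrt_continuous R))).
apply: measurable_funM => //; rewrite /event_count.
under eq_fun do rewrite natr_sum; apply: measurable_sum => t.
by under eq_fun do rewrite tnth_mktuple; exact: measurable_event.
Qed.

Hypotheses (T0 : (0 < T)%N) (K0 : 0 <= K) (EE0 : EE !=set0).

Lemma measurable_excess_bias :
  measurable_fun setT (fun w => excess_bias (forecasts F y w) y EE K).
Proof.
have /finite_seqP[es EEs] := EE_fin.
have [E0 EE_E0] := EE0.
(* The finite family becomes a sequence with default event [E0], itself in [EE]: the supremum is
   unchanged, and countable suprema preserve measurability. *)
pose h n w := conditional_bias (forecasts F y w) y (nth E0 es n) -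
  K * bias_rate EE (forecasts F y w) (nth E0 es n).
have nthE n : EE (nth E0 es n).
  have [nes|nes] := ltnP n (size es); last by rewrite nth_default.
  by rewrite EEs /= mem_nth.
have hE w : range (h ^~ w) = [set conditional_bias (forecasts F y w) y E -
    K * bias_rate EE (forecasts F y w) E | E in EE].
  apply/seteqP; split => _ [x Ex <-]; first by exists (nth E0 es x).
  move: Ex; rewrite {1}EEs /= => xes; exists (index x es) => //.
  by rewrite /h nth_index.
rewrite (_ : (fun _ => _) = fun w => sups (h ^~ w) 0).
  apply: measurable_fun_sups => [w _|n].
    by rewrite hE; exact: excess_bias_has_ubound.
  apply: measurable_funB; first exact: measurable_conditional_bias.
  by apply: measurable_funM => //; exact: measurable_bias_rate.
apply/funext => w; rewrite /excess_bias -hE /sups /sdrop; congr sup.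
by apply/seteqP; split => _ [n _ <-]; exists n.
Qed.

Lemma integrable_excess_bias (Pr : probability Omega R) :
  Pr.-integrable setT (EFin \o (fun w => excess_bias (forecasts F y w) y EE K)).
Proof.
apply: measurable_bounded_integrable => //.
- by rewrite /= [ltLHS]probability_setT ltry.
- exact: measurable_excess_bias.
have [E0 EE_E0] := EE0; pose l : R := ln (#|Y| * cardinal EE * T)%N%:R.
(* [M] bounds [K] times any rate, as no event occurs more than [T] times; the excess then lies
   between - M and 2. *)
pose M := K * (#|Y|%:R * l / T%:R + #|Y|%:R * Num.sqrt (l * T%:R) / T%:R).
have M0 : 0 <= M.
  by rewrite /M mulr_ge0 // addr_ge0 // !mulr_ge0 ?invr_ge0 ?sqrtr_ge0 ?ln_nat_ge0.
exists (M + 2); split; first exact: num_real.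
move=> b Mb w _; apply: le_trans (ltW Mb); rewrite ler_norml; apply/andP; split.
  apply: (@le_trans _ _ (- M)); first by rewrite opprD gerDl oppr_le0.
  have := conditional_bias_le (forecasts F y w) y T0 K0 EE_E0.
  have := conditional_bias_ge0 (forecasts F y w) y E0.
  suff : K * bias_rate EE (forecasts F y w) E0 <= M by lra.
  rewrite ler_wpM2l // lerD2l ler_wpM2r ?invr_ge0 // ler_wpM2l //.
  rewrite ler_wsqrtr // ler_wpM2l ?ln_nat_ge0 // ler_nat.
  rewrite -[leqRHS](card_ord T) -sum1_card; apply: leq_sum => t _.
  exact: leq_b1.
apply: ge_sup => [|_ [E EEE <-]]; first by eexists; exists E0.
have := conditional_bias_le2 (forecasts F y w) y T0 E.
have := bias_rate_ge0 (forecasts F y w) EE E => /(mulr_ge0 K0).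
by lra.
Qed.

End ExcessBiasIntegral.

(** * Counting the events *)

Section EventCount.
Context (R : realType) (Y A : finType) (P : choiceType) (P0 : {fset P}).
Context (astar aeps : P -> dist R Y -> A) (popt oracle : dist R Y -> P).
Hypothesis oracle_fin : finite_set (range oracle).

Let events : seq (event R Y) :=
  [seq (fun pi => (oracle pi, astar (oracle pi) pi) == (p, r))
    | p <- fset_set (range oracle), r <- enum A] ++
  [seq (fun pi => (popt pi, aeps (popt pi) pi) == (p, a)) | p <- P0, a <- enum A] ++
  [seq (fun pi => astar p0 pi == a) | p0 <- P0, a <- enum A].

Let mem_events E : all_events P0 astar aeps popt oracle E -> E \in events.
Proof.
rewrite !mem_cat => -[[[p [r [pO ->]]]|[p [a [pP ->]]]]|[p [a [pP ->]]]].
- apply/orP; left; apply/allpairsP; exists (p, r).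
  by rewrite in_fset_set // mem_set // mem_enum.
- apply/orP; right; apply/orP; left; apply/allpairsP; exists (p, a).
  by rewrite mem_enum.
- apply/orP; right; apply/orP; right; apply/allpairsP; exists (p, a).
  by rewrite mem_enum.
Qed.

Lemma all_events_finite : finite_set (all_events P0 astar aeps popt oracle).
Proof.
apply: (@sub_finite_set _ _ [set` events]); last exact: finite_seq.
by move=> E /mem_events.
Qed.

Lemma cardinal_all_events :
  (cardinal (all_events P0 astar aeps popt oracle) <=
   cardinal (range oracle) * #|A| + #|` P0| * #|A| + #|` P0| * #|A|)%N.
Proof.
apply: (@leq_trans (size events)); last first.
  by rewrite !size_cat !size_allpairs -!cardE addnA.
apply: uniq_leq_size; first exact: fset_uniq.
by move=> E; rewrite in_fset_set ?inE; [move=> /mem_events|exact: all_events_finite].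
Qed.

End EventCount.

(** * Logarithmic factors and explicit constants *)

Lemma ln_count_le (R : realType) (nY nA nP0 nPO T n : nat) :
  (0 < nY)%N -> (0 < nA)%N -> (0 < nP0)%N -> (0 < nPO)%N -> (0 < T)%N ->
  (n <= nPO * nA + nP0 * nA + nP0 * nA)%N ->
  ln (nY * n * T)%N%:R <= 2 * (1 + ln (T * nY * nPO * nP0 * nA)%N%:R) :> R.
Proof.
move=> nY0 nA0 nP00 nPO0 T0 nle; set N := (T * nY * nPO * nP0 * nA)%N.
have N0 : (0 < N)%N by rewrite !muln_gt0 T0 nY0 nPO0 nP00.
have lnN0 : 0 <= ln N%:R :> R by exact: ln_nat_ge0.
have [->|m0] := posnP (nY * n * T)%N; first by rewrite ln0 //; lra.
(* Each of the three summands bounding [n] is at most [nPO * nP0 * nA], all cardinalities being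
   positive. *)
have mN : (nY * n * T <= 3 * N)%N.
  rewrite -mulnA mulnC; apply: (@leq_trans (3 * (nPO * nP0 * nA) * T * nY)); last first.
    by rewrite /N; lia.
  rewrite leq_mul2r leq_mul2r; apply/orP; right; apply/orP; right.
  by apply: leq_trans nle _; nia.
apply: (@le_trans _ _ (ln (3 * N%:R))).
  by rewrite ler_ln ?posrE ?mulr_gt0 ?ltr0n // -natrM ler_nat.
(* ln 3 is at most 2, by ln (1 + x) <= x at x = 2. *)
rewrite lnM ?posrE ?ltr0n // (_ : 3 = 1 + 2); last by lra.
by have := @le_ln1Dx R 2; lra.
Qed.

(** With at most [T] contexts, x = m / T is at most its root [r], so the linear part of the rate is
    absorbed by the square-root part at the price of one factor [Lam]. *)
Lemma context_error_le (R : realType) (Y A : finType) (P : choiceType)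
    (P0 : {fset P}) (astar aeps : P -> dist R Y -> A) (popt oracle : dist R Y -> P)
    (eps_swap Kf Ks : R) (T m : nat) (delta X Lam : R) :
  0 <= eps_swap -> 0 <= Kf -> 0 <= Ks -> (0 < T)%N -> (m <= T)%N -> 0 < delta ->
  1 <= Lam -> (0 < #|Y|)%N ->
  ln (#|Y| * cardinal (all_events P0 astar aeps popt oracle) * T)%N%:R <= 2 * Lam ->
  let s := #|Y|%:R * Num.sqrt (m%:R / T%:R) in
  (context_error P0 astar aeps popt oracle eps_swap Kf Ks T m delta X <=
  (4 / delta + 1) * m%:R * X +
  Lam * ((2 + 2 * Ks + 16 * Kf) * ((eps_swap + s) / delta) + (Ks + 4 * Kf) * s) : Prop).
Proof.
move=> es0 Kf0 Ks0 T0 mT delta0 Lam1 nY0 lL s; rewrite /context_error.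
set l := ln _ in lL *; have l0 : 0 <= l by exact: ln_nat_ge0.
set x := m%:R / T%:R in s *; set r := Num.sqrt x in s *.
have x0 : 0 <= x by rewrite divr_ge0.
have r0 : 0 <= r by exact: sqrtr_ge0.
have x1 : x <= 1 by rewrite ler_pdivrMr ?ltr0n // mul1r ler_nat.
have r1 : r <= 1 by rewrite -sqrtr1 ler_wsqrtr.
have xr : x = r * r by rewrite -expr2 sqr_sqrtr.
have nY1 : 1 <= #|Y|%:R :> R by rewrite ler1n.
have rs : r <= s by rewrite /s ler_peMl.
(* [l] is at most 2 Lam, hence at most its square because [Lam] is at least 1. *)
have sl : Num.sqrt l <= 2 * Lam.
  rewrite -ler_sqr ?nnegrE ?sqrtr_ge0 ?sqr_sqrtr //; last by lra.
  by nra.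
have lr : l * x + Num.sqrt l * r <= 4 * Lam * r.
  have h1 : l * x <= 2 * Lam * r by rewrite ler_pM // xr ler_piMl.
  by have := ler_wpM2r r0 sl; lra.
have h2 : Kf * (#|Y|%:R * (l * x + Num.sqrt l * r)) <= 4 * Kf * Lam * s.
  have -> : 4 * Kf * Lam * s = Kf * (#|Y|%:R * (4 * Lam * r)) by rewrite /s; ring.
  by rewrite ler_wpM2l // ler_wpM2l.
set e := Kf * _ in h2 *.
have s0 : 0 <= s by exact: le_trans rs.
have h3 : Ks * r <= Ks * Lam * s.
  rewrite -mulrA ler_wpM2l //; apply: le_trans rs _.
  by rewrite ler_peMl.
have h4 : eps_swap <= Lam * eps_swap by rewrite ler_peMl.
have h5 : 0 <= Lam * s by rewrite mulr_ge0 //; lra.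
have k0 : 0 <= delta^-1 by rewrite invr_ge0 ltW.
have h7 : 0 <= Lam * eps_swap by rewrite mulr_ge0 //; lra.
have h6 : 2 * (eps_swap + Ks * r + 2 * e) <=
    Lam * ((2 + 2 * Ks + 16 * Kf) * (eps_swap + s)).
  have := mulr_ge0 Ks0 h7; have := mulr_ge0 Kf0 h7; lra.
have := ler_wpM2l k0 h6; lra.
Qed.

(** A sample point provides a forecast, which in turn witnesses that actions, benchmarks and oracle
    outputs exist. *)
Lemma probability_exists d (Omega : measurableType d) (R : realType)
  (Pr : probability Omega R) : exists w : Omega, True.
Proof.
apply: contrapT => no; have := probability_setT Pr.
rewrite (_ : setT = set0) ?measure0; first by move=> /eqP; rewrite eq_sym onee_eq0.
by apply/seteqP; split => // w _; apply: no; exists w.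
Qed.

Theorem theorem2 (R : realType) :
  exists k : nat, forall K_forecast K_secret beta_max : R,
  0 <= K_forecast -> 0 <= K_secret ->
  exists K : R,
  forall (Y A : finType) (P : choiceType) (P0 : {fset P})
    (U V : A -> P -> Y -> R)
    (astar aeps : P -> dist R Y -> A) (popt oracle : dist R Y -> P)
    (c eps beta gamma eps_swap : R)
    (T : nat) (y : T.-tuple Y) (L : learner R Y A P)
    (d : measure_display) (Omega : measurableType d)
    (Pr : probability Omega R) (F : forecaster R Y Omega),
  (forall a p s, -1 <= U a p s <= 1) ->
  (forall a p s, -1 <= V a p s <= 1) ->
  (0 < T)%N ->
  0 <= c -> 0 < eps -> 0 < beta <= beta_max -> 0 <= gamma ->
  is_astar U V astar ->
  is_astar_eps U V astar eps aeps ->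
  is_popt V P0 aeps popt ->
  optimal_stable_oracle U V P0 astar aeps c beta gamma oracle ->
  finite_set (range oracle) ->
  unbiased_forecaster T Pr (all_events P0 astar aeps popt oracle) K_forecast F ->
  (forall w, no_contextual_swap_regret U P0 astar oracle eps_swap L y
               (forecasts F y w)) ->
  no_secret_information U V P0 astar oracle K_secret L y ->
  let nY := #|Y| in
  let nA := #|A| in
  let nP0 := #|` P0| in
  let nPO := cardinal (range oracle) in
  (mechanism_policy_regret V P0 astar Pr F oracle L y <=
   (K * (1 + ln (T * nY * nPO * nP0 * nA)%N%:R) ^+ k *
    (c + gamma + Num.sqrt ((nP0 * nA)%N%:R / T%:R)
     + (eps_swap + nY%:R * Num.sqrt ((nPO * nA)%N%:R / T%:R)) / beta
     + (eps_swap + nY%:R * Num.sqrt (nA%:R / T%:R)) / eps))%:E)%E.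
Proof.
exists 1%N => Kf Ks bm Kf0 Ks0; set K1 := 2 + 2 * Ks + 16 * Kf.
(* [K1] multiplies the terms over beta and eps; the second summand absorbs the terms without a
   denominator, the third covers the case of more contexts than rounds. *)
exists (K1 + 2 * (Ks + 4 * Kf) * bm + 2 * bm).
move=> Y A P P0 U V astar aeps popt oracle c eps beta gamma eps_swap T y L d Omega Pr F.
move=> U1' V1' T0 c0 eps0 /andP[beta0 beta_bm] gamma0 astarP aepsP poptP oracleP.
move=> oracle_fin [FM bias0] swapP secretP; cbv zeta.
set nY := #|Y|; set nA := #|A|; set nP0 := #|` P0|; set nPO := cardinal _.
have U1 a p s : `|U a p s| <= 1 by rewrite ler_norml.
have V1 a p s : `|V a p s| <= 1 by rewrite ler_norml.
have [w0 _] := probability_exists Pr.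
have TR : 0 < T%:R :> R by rewrite ltr0n.
pose t0 := Ordinal T0; pose pi0 := tnth (forecasts F y w0) t0.
have nY0 : (0 < nY)%N by apply/card_gt0P; exists (tnth y t0).
have nA0 : (0 < nA)%N by apply/card_gt0P; exists (astar (oracle pi0) pi0).
have nP00 : (0 < nP0)%N.
  by rewrite cardfs_gt0; apply/fset0Pn; exists (popt pi0); exact: (poptP _).1.
have nPO0 : (0 < nPO)%N.
  rewrite cardfs_gt0; apply/fset0Pn; exists (oracle pi0).
  by rewrite in_fset_set // mem_set //; exists pi0.
have es0 : 0 <= eps_swap.
  apply: le_trans (swapP w0).1; rewrite -[leLHS](expect_cst L y
    (map_tuple oracle (forecasts F y w0)) (recommendations astar
      (map_tuple oracle (forecasts F y w0)) (forecasts F y w0))).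
  by apply: le_expect => acts; exact: swap_regret_ge0.
set Lam := 1 + ln _; rewrite expr1.
have Lam1 : 1 <= Lam by rewrite lerDl ln_nat_ge0.
set EE := all_events _ _ _ _ _ in FM bias0.
have EE_fin : finite_set EE by exact: all_events_finite.
have EE0 : EE !=set0.
  exists (fun pi => (oracle pi, astar (oracle pi) pi) ==
    (oracle pi0, astar (oracle pi0) pi0)).
  by left; left; exists (oracle pi0), (astar (oracle pi0) pi0); split => //; exists pi0.
have lL : ln (#|Y| * cardinal EE * T)%N%:R <= 2 * Lam.
  by apply: ln_count_le => //; exact: cardinal_all_events.
have bm0 : 0 < bm by exact: lt_le_trans beta_bm.
have nY1 : 1 <= nY%:R :> R by rewrite ler1n.
set q := Num.sqrt ((nP0 * nA)%N%:R / T%:R); have q0 : 0 <= q by exact: sqrtr_ge0.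
set s := nY%:R * Num.sqrt ((nPO * nA)%N%:R / T%:R).
set z := nY%:R * Num.sqrt (nA%:R / T%:R).
have s0 : 0 <= s by rewrite mulr_ge0 ?sqrtr_ge0.
have z0 : 0 <= z by rewrite mulr_ge0 ?sqrtr_ge0.
have zs : z <= s.
  rewrite ler_wpM2l // ler_wsqrtr // ler_wpM2r ?invr_ge0 // ler_nat.
  by rewrite leq_pmull.
set a := (eps_swap + s) / beta; set b := (eps_swap + z) / eps.
have a0 : 0 <= a by rewrite divr_ge0 ?addr_ge0 ?(ltW beta0).
have b0 : 0 <= b by rewrite divr_ge0 ?addr_ge0 ?(ltW eps0).
(* The upper bound on [beta] enters here: terms in [s] that lack the factor 1 / beta are charged to
   [a]. *)
have sa : s <= bm * a.
  have -> : s = beta * (s / beta) by rewrite mulrC divfK ?gt_eqF.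
  rewrite ler_pM ?divr_ge0 ?(ltW beta0) // /a ler_wpM2r ?invr_ge0 ?(ltW beta0) //.
  by rewrite lerDr.
have K10 : 1 <= K1 by rewrite /K1; lra.
have Ks4 : 0 <= Ks + 4 * Kf by lra.
set K := K1 + _ + _; set S := c + gamma + q + a + b.
have S0 : 0 <= c + gamma + q by rewrite !addr_ge0.
(* [context_error_le] requires at most [T] contexts. Beyond that [s] is at least 1, and the trivial
   bound 2 is at most 2 bm a. *)
have [mT|Tm] := leqP (nPO * nA) T; last first.
  apply: (@le_trans _ _ (\int[Pr]_w (2%R : R)%:E)%E).
    apply: le_integral_pointwise => w; rewrite lee_fin.
    exact: (policy_regret_le2 _ _ _ _ V1 T0 poptP).
  rewrite integral_cst //= [X in (_ * X)%E]probability_setT mule1 lee_fin.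
  have s1 : 1 <= s.
    rewrite /s mulr_ege1 // -[X in X <= _]sqrtr1 ler_wsqrtr //.
    rewrite ler_pdivlMr // mul1r ler_nat.
    exact: ltnW.
  have KS : 2 * bm * a <= K * S.
    apply: ler_pM => //; first by rewrite mulr_ge0 ?(ltW bm0).
      by rewrite /K lerDr addr_ge0 ?mulr_ge0 ?(ltW bm0) //; lra.
    by rewrite /S; lra.
  have KS0 : 0 <= K * S by apply: le_trans KS; rewrite mulr_ge0 // mulr_ge0 ?(ltW bm0).
  have := ler_wpM2r KS0 Lam1; rewrite mulrAC; lra.
have nAT : (nA <= T)%N by apply: leq_trans mT; rewrite leq_pmull.
pose X w := excess_bias (forecasts F y w) y EE Kf.
(* [D] collects the slopes of both context errors in the excess bias, and [C] below the terms free
   of it. *)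
pose D := (4 / beta + 1) * (nPO * nA)%N%:R + (4 / eps + 1) * nA%:R.
have D0 : 0 <= D.
  by rewrite addr_ge0 // mulr_ge0 // addr_ge0 // divr_ge0 // ltW.
pose C := c + gamma + Lam * (K1 * a + (Ks + 4 * Kf) * s) +
  Lam * (K1 * b + (Ks + 4 * Kf) * z).
apply: (@le_trans _ _ (\int[Pr]_w (C + D * X w)%:E)%E).
  apply: le_integral_pointwise => w; rewrite lee_fin.
  apply: le_trans (policy_regret_le U1 V1 T0 eps0 beta0 gamma0 Kf0 Ks0 astarP aepsP
    poptP oracleP oracle_fin secretP (swapP w)) _.
  have := context_error_le (X w) es0 Kf0 Ks0 T0 mT beta0 Lam1 nY0 lL.
  have := context_error_le (X w) es0 Kf0 Ks0 T0 nAT eps0 Lam1 nY0 lL.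
  by rewrite -/EE -/(X w) /C /D /= -/nY -/s -/z -/K1 -/a -/b; lra.
apply: (@le_trans _ _ C%:E).
  apply: integral_affine_le => //; last exact: bias0.
  exact: integrable_excess_bias.
rewrite lee_fin mulrAC [leRHS]mulrC /C.
have Lam0 : 0 <= Lam by lra.
have h1 : c + gamma <= Lam * (c + gamma) by rewrite ler_peMl // addr_ge0.
(* As [z <= s], the beta term absorbs both. *)
have h2 : (Ks + 4 * Kf) * (s + z) <= (Ks + 4 * Kf) * (2 * (bm * a)).
  by rewrite ler_wpM2l //; lra.
suff : c + gamma + K1 * a + K1 * b + (Ks + 4 * Kf) * (2 * (bm * a)) <= K * S.
  move=> h3; have h23 := le_trans (lerD (lexx (c + gamma + K1 * a + K1 * b)) h2) h3.
  by have := ler_wpM2l Lam0 h23; lra.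
have h4 : c + gamma <= K1 * (c + gamma + q) by nra.
have h5 : 0 <= 2 * (Ks + 4 * Kf) * bm * (c + gamma + q + b).
  apply: mulr_ge0; last exact: addr_ge0.
  by rewrite mulr_ge0 ?(ltW bm0) // mulr_ge0.
have h6 : 0 <= 2 * bm * S.
  by rewrite mulr_ge0 /S ?addr_ge0 // ?(ltW bm0) // mulr_ge0 ?(ltW bm0).
by rewrite /K /S in h6 *; lra.
Qed.
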